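(* Let $M$ be a strictly totally ordered monoid with $|M|\geq 2$ and let $R$ be an $M$-central Armendariz ring. Then $R$ is a Baer ring if and only if $R[M]$ is a Baer ring.
   Context: All rings are associative with identity. $C(R)$ denotes the center of a ring $R$, and $R[M]$ denotes the monoid ring of a monoid $M$ over $R$. A ring $R$ is called $M$-central Armendariz if whenever $\alpha=a_1g_1+\dots+a_mg_m\in R[M]$ and $\beta=b_1h_1+\dots+b_nh_n\in R[M]$ (with $a_i,b_j\in R$, $g_1,\dots,g_m\in M$ pairwise distinct, and $h_1,\dots,h_n\in M$ pairwise distinct) satisfy $\alpha\beta=0$, then $a_ib_j\in C(R)$ for all $1\le i\le m$ and $1\le j\le n$. A ring $S$ is a Baer ring if the right annihilator of every nonempty subset of $S$ is generated by an idempotent, i.e. for each nonempty $W\subseteq S$ there is an idempotent $f\in S$ with $\{s\in S: ws=0 \text{ for all } w\in W\}=fS$ (this condition is equivalent to its left-hand analogue). An ordered monoid $(M,\le)$ is strictly ordered if for all $g,g',h\in M$, $g<g'$ implies $gh<g'h$ and $hg<hg'$. It is strictly totally ordered if in addition $\le$ is a total order. *)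

(* Defs.v *)
From HB Require Import structures.
From mathcomp Require Import all_boot all_order all_algebra.
From mathcomp Require Import finmap monalg.

Set Implicit Arguments.
Unset Strict Implicit.
Unset Printing Implicit Defensive.

Import Order.TTheory GRing.Theory.

Local Open Scope fset_scope.
Local Open Scope ring_scope.

HB.mixin Record isStrictlyOrderedMonoid (d : Order.disp_t) M
    of monoid.Monoid M & Order.POrder d M := {
  lt_mulgr : forall g g' h : M, (g < g')%O -> ((g * h)%g < (g' * h)%g)%O;
  lt_mulgl : forall g g' h : M, (g < g')%O -> ((h * g)%g < (h * g')%g)%O
}.

#[short(type="strictTotalMonoidType")]
HB.structure Definition StrictTotalMonoid (d : Order.disp_t) :=
  { M of isStrictlyOrderedMonoid d M & monoid.Monoid M & Order.Total d M }.

(* The finitely supported functions from M to R, with the convolution product.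
   This is an alias of the additive group {malg R[M]}: the ring structure which
   monalg puts on {malg R[M]} needs a monomType, that is a monoid in which
   g * h = 1 implies g = h = 1, and a nonzero ring R. *)
Definition monoid_ring (R : pzRingType) (M : monoidType) : Type := {malg R[M]}.

HB.instance Definition _ (R : pzRingType) (M : monoidType) :=
  GRing.Zmodule.copy (monoid_ring R M) {malg R[M]}.

Section MonoidRing.
Context (R : pzRingType) (M : monoidType).
Implicit Types (x y z : monoid_ring R M) (c : R) (g h : M).

Definition mr_one : monoid_ring R M := << 1 *g 1%g >>.

Definition mr_mul x y : monoid_ring R M :=
  \sum_(g <- msupp x) \sum_(h <- msupp y) << x@_g * y@_h *g (g * h)%g >>.

Lemma mr_mulEw (d1 d2 : {fset M}) x y :
  msupp x `<=` d1 -> msupp y `<=` d2 ->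
  mr_mul x y =
  \sum_(g <- d1) \sum_(h <- d2) << x@_g * y@_h *g (g * h)%g >>.
Proof.
move=> le_d1 le_d2; rewrite /mr_mul (big_fset_incl _ le_d1) /=.
  apply/eq_bigr=> g _; apply/big_fset_incl => // h _ /mcoeff_outdom ->.
  by rewrite mulr0 monalgU0.
move=> g _ /mcoeff_outdom xg.
by rewrite big1 // => h _; rewrite xg mul0r monalgU0.
Qed.

Lemma mr_mulUU c1 c2 g h :
  mr_mul << c1 *g g >> << c2 *g h >> = << c1 * c2 *g (g * h)%g >>.
Proof. by rewrite (mr_mulEw msuppU_le msuppU_le) !big_seq_fset1 !mcoeffUU. Qed.

Lemma mr_mulDl : left_distributive mr_mul +%R.
Proof.
move=> x y z.
rewrite (mr_mulEw (msuppD_le x y) (fsubset_refl (msupp z))).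
rewrite (mr_mulEw (fsubsetUl (msupp x) (msupp y)) (fsubset_refl (msupp z))).
rewrite (mr_mulEw (fsubsetUr (msupp x) (msupp y)) (fsubset_refl (msupp z))).
rewrite -big_split /=; apply/eq_bigr=> g _.
rewrite -big_split /=; apply/eq_bigr=> h _.
by rewrite mcoeffD mulrDl monalgUD.
Qed.

Lemma mr_mulDr : right_distributive mr_mul +%R.
Proof.
move=> x y z.
rewrite (mr_mulEw (fsubset_refl (msupp x)) (msuppD_le y z)).
rewrite (mr_mulEw (fsubset_refl (msupp x)) (fsubsetUl (msupp y) (msupp z))).
rewrite (mr_mulEw (fsubset_refl (msupp x)) (fsubsetUr (msupp y) (msupp z))).
rewrite -big_split /=; apply/eq_bigr=> g _.
rewrite -big_split /=; apply/eq_bigr=> h _.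
by rewrite mcoeffD mulrDr monalgUD.
Qed.

Lemma mr_mul0l : left_zero 0 mr_mul.
Proof. by move=> x; rewrite /mr_mul msupp0 big_seq_fset0. Qed.

Lemma mr_mul0r : right_zero 0 mr_mul.
Proof. by move=> x; rewrite /mr_mul msupp0 big1 // => g _; rewrite big_seq_fset0. Qed.

Lemma mr_mul_suml I (r : seq I) (F : I -> monoid_ring R M) x :
  mr_mul (\sum_(i <- r) F i) x = \sum_(i <- r) mr_mul (F i) x.
Proof. exact: (big_morph (mr_mul^~ x) (fun u v => mr_mulDl u v x) (mr_mul0l x)). Qed.

Lemma mr_mul_sumr I (r : seq I) (F : I -> monoid_ring R M) x :
  mr_mul x (\sum_(i <- r) F i) = \sum_(i <- r) mr_mul x (F i).
Proof. exact: (big_morph (mr_mul x) (mr_mulDr x) (mr_mul0r x)). Qed.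

Lemma mr_mul1l : left_id mr_one mr_mul.
Proof.
move=> x; rewrite [x in LHS]monalgE mr_mul_sumr [RHS]monalgE.
by apply/eq_bigr=> g _; rewrite mr_mulUU mul1r mul1g.
Qed.

Lemma mr_mul1r : right_id mr_one mr_mul.
Proof.
move=> x; rewrite [x in LHS]monalgE mr_mul_suml [RHS]monalgE.
by apply/eq_bigr=> g _; rewrite mr_mulUU mulr1 mulg1.
Qed.

Lemma mr_mulEl x y : mr_mul x y = \sum_(g <- msupp x) mr_mul << x@_g *g g >> y.
Proof. by rewrite [x in LHS]monalgE mr_mul_suml. Qed.

Lemma mr_mulEr x y : mr_mul x y = \sum_(h <- msupp y) mr_mul x << y@_h *g h >>.
Proof. by rewrite [y in LHS]monalgE mr_mul_sumr. Qed.

Lemma mr_mulA : associative mr_mul.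
Proof.
move=> x y z; rewrite (mr_mulEl x (mr_mul y z)) (mr_mulEl x y) mr_mul_suml.
apply/eq_bigr=> g _; rewrite (mr_mulEl y z) mr_mul_sumr (mr_mulEr _ y).
rewrite mr_mul_suml; apply/eq_bigr=> h _.
rewrite (mr_mulEr _ z) mr_mul_sumr mr_mulUU (mr_mulEr _ z).
by apply/eq_bigr=> k _; rewrite !mr_mulUU mulrA mulgA.
Qed.

HB.instance Definition _ := GRing.Zmodule_isPzRing.Build (monoid_ring R M)
  mr_mulA mr_mul1l mr_mul1r mr_mulDl mr_mulDr.
End MonoidRing.

Definition central (R : pzRingType) (a : R) : Prop :=
  forall r : R, GRing.comm a r.

Definition mr_term (R : pzRingType) (M : monoidType) (a : R) (g : M) :
  monoid_ring R M := << a *g g >>.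

Definition central_Armendariz (M : monoidType) (R : pzRingType) : Prop :=
  forall (m n : nat) (a : 'I_m -> R) (g : 'I_m -> M)
         (b : 'I_n -> R) (h : 'I_n -> M),
    injective g -> injective h ->
    (\sum_(i < m) mr_term (a i) (g i)) * (\sum_(j < n) mr_term (b j) (h j)) = 0 ->
    forall (i : 'I_m) (j : 'I_n), central (a i * b j).

Definition Baer (S : pzRingType) : Prop :=
  forall W : S -> Prop, (exists w, W w) ->
    exists f : S, f * f = f /\
      forall s : S, (forall w, W w -> w * s = 0) <-> (exists t : S, s = f * t).

(* Main.v *)
Require Import Defs.
From mathcomp Require Import all_boot all_order all_algebra.
From mathcomp Require Import finmap monalg.

Set Implicit Arguments.
Unset Strict Implicit.
Unset Printing Implicit Defensive.

Import Order.TTheory GRing.Theory.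

Local Open Scope ring_scope.

(** When R is Baer, the Armendariz hypothesis makes R reduced, and over a reduced
    ring a product in the monoid ring vanishes only coefficientwise.

    If R is central Armendariz relative to a monoid with an element k <> 1,
    then each corner e R (1 - e) of an idempotent e is zero: an element n of the
    corner produces the zero product (e + n k) ((1 - e) - n k) = 0, so that
    e n = n is central, and a central element of the corner is zero.  Hence all
    idempotents of R are central ([central_Armendariz_idem_central]).
    A Baer ring with central idempotents is reduced: if a a = 0 then a lies in its
    own annihilator e R, whence a = e a = a e = 0 ([abelian_Baer_reduced]).
    Over a reduced ring and a strictly totally ordered monoid, x y = 0 forces every product of a
    coefficient of x with a coefficient of y to be zero
    ([reduced_Armendariz]).  So the annihilator of a set W in the monoid ring
    consists of the elements whose coefficients annihilate all coefficients of
    W, and the idempotent that generates the annihilator of these coefficients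
    in R also generates the annihilator of W ([Baer_monoid_ring]).

    Conversely, an element annihilates constants exactly when each of its
    coefficients does.  If f generates the annihilator of a set of constants in
    the monoid ring, comparing coefficients at 1 in s = f s, for a constant s
    of the annihilator, shows that the coefficient of f at 1 generates the
    annihilator in R ([Baer_coefficient_ring]). *)

Lemma exists_seq_min (d : Order.disp_t) (O : orderType d) (T : eqType)
    (f : T -> O) (s : seq T) :
  s != [::] -> exists2 x, x \in s & forall y, y \in s -> (f x <= f y)%O.
Proof.
elim: s => [//|z s IHs] _; have [->|/IHs[x xs x_min]] := eqVneq s [::].
  by exists z => [|y]; rewrite ?mem_head// inE => /eqP->.
have [le_xz|lt_zx] := leP (f x) (f z).
  by exists x => [|y]; rewrite inE ?xs ?orbT// => /predU1P[->|/x_min].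
exists z => [|y]; first exact: mem_head.
by rewrite inE => /predU1P[->//|/x_min]; apply/le_trans/ltW.
Qed.

Section Coefficients.
Context (R : pzRingType) (M : monoidType).
Implicit Types (x y : monoid_ring R M) (a b c : R) (g h k : M).

Lemma mcoeff_mul x y k :
  (x * y)@_k = \sum_(g <- msupp x) \sum_(h <- msupp y)
                 (x@_g * y@_h) *+ ((g * h)%g == k).
Proof.
rewrite [x * y]/(mr_mul x y) /mr_mul raddf_sum; apply/eq_bigr => g _.
by rewrite raddf_sum; apply/eq_bigr => h _; rewrite /= mcoeffU.
Qed.

Lemma mr_termM a b g h :
  mr_term a g * mr_term b h = mr_term (a * b) (g * h)%g.
Proof. exact: mr_mulUU. Qed.

Lemma mcoeff_constl c x k : (mr_term c (1%g : M) * x)@_k = c * x@_k.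
Proof.
have -> : mr_term c 1%g * x = _ := mr_mulEw msuppU_le (fsubset_refl (msupp x)).
rewrite big_seq_fset1 raddf_sum mcoeffUU [x in RHS]monalgE !raddf_sum mulr_sumr.
by apply/eq_bigr => h _; rewrite /= mul1g !mcoeffU mulrnAr.
Qed.

Lemma mcoeff_constr x c k : (x * mr_term c (1%g : M))@_k = x@_k * c.
Proof.
have -> : x * mr_term c 1%g = _ := mr_mulEw (fsubset_refl (msupp x)) msuppU_le.
rewrite raddf_sum [x in RHS]monalgE !raddf_sum mulr_suml.
apply/eq_bigr => h _; rewrite big_seq_fset1 /= mcoeffUU mulg1 !mcoeffU.
by rewrite mulrnAl.
Qed.

End Coefficients.

(** The two elements e + n k and (1 - e) - n k, with n = e r (1 - e), have zero
    product because e n = n, n e = 0 and hence n n = 0; the product of the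
    coefficients e and - n is - n.  Once n is known to be central,
    n = e n = n e = 0.  The same for 1 - e gives e r = e r e = r e. *)
Lemma central_Armendariz_idem_central (M : monoidType) (R : pzRingType) (k : M) :
  k != 1%g -> central_Armendariz M R ->
  forall e : R, e * e = e -> central e.
Proof.
move=> k1 hR; pose g (i : 'I_2) : M := if i == ord0 then 1%g else k.
have g_inj : injective g.
  move=> i j; rewrite /g; case: (eqVneq i ord0) => [->|i0].
    by case: (eqVneq j ord0) => [->|_ /esym/eqP] //; rewrite (negPf k1).
  case: (eqVneq j ord0) => [_ /eqP|j0 _]; first by rewrite (negPf k1).
  by apply/val_inj; case: i i0 j j0 => [[|[|//]] ?] // _ [[|[|//]] ?].
have corner0 (e r : R) : e * e = e -> e * r * (1 - e) = 0.
  move=> ee; set n := e * r * (1 - e).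
  have en : e * n = n by rewrite /n !mulrA ee.
  have ne : n * e = 0 by rewrite /n -!mulrA mulrBl mul1r ee subrr !mulr0.
  pose a (i : 'I_2) := if i == ord0 then e else n.
  pose b (i : 'I_2) := if i == ord0 then 1 - e else - n.
  have ab0 : (\sum_(i < 2) mr_term (a i) (g i)) *
             (\sum_(j < 2) mr_term (b j) (g j)) = 0.
    rewrite !big_ord_recl !big_ord0 !addr0 mulrDl !mulrDr.
    rewrite !mr_termM /a /b /g /= mul1g !mulg1.
    have nn : n * n = 0 by rewrite -{2}en mulrA ne mul0r.
    rewrite !mulrN !mulrBr !mulr1 ee ne en nn subrr subr0 oppr0.
    by rewrite /mr_term !monalgU0 add0r addr0 mul1g -monalgUD addNr monalgU0.
  have := hR _ _ _ _ _ _ g_inj g_inj ab0 ord0 (lift ord0 ord0).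
  rewrite /a /b /= mulrN en => /(_ e).
  by rewrite /GRing.comm mulNr mulrN ne en oppr0 => /esym/eqP; rewrite oppr_eq0 => /eqP.
move=> e ee r.
have /eqP := corner0 e r ee; rewrite mulrBr mulr1 subr_eq0 => /eqP er.
have ee' : (1 - e) * (1 - e) = 1 - e.
  by rewrite mulrBr mulr1 mulrBl mul1r ee subrr subr0.
have /eqP := corner0 _ r ee'.
rewrite opprB addrCA subrr addr0 !mulrBl mul1r subr_eq0 => /eqP re.
by rewrite /GRing.comm er re.
Qed.

(** An element of square zero lies in its own annihilator e R, so that e fixes it
    from the left and kills it from the right; a central e cannot do both unless
    the element is zero. *)
Lemma abelian_Baer_reduced (R : pzRingType) :
  (forall e : R, e * e = e -> central e) -> Baer R ->
  forall a : R, a * a = 0 -> a = 0.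
Proof.
move=> idemC baerR a aa0.
have [|e [ee annE]] := baerR (fun w => w = a); first by exists a.
have [t at_] : exists t, a = e * t by apply/annE => _ ->.
have ae0 : a * e = 0.
  by apply: (proj2 (annE e)) => //; exists 1; rewrite mulr1.
by rewrite -ae0 -(idemC e ee a) {2}at_ mulrA ee -at_.
Qed.

Lemma reduced_mul0C (R : pzRingType) :
  (forall a : R, a * a = 0 -> a = 0) ->
  forall a b : R, a * b = 0 -> b * a = 0.
Proof.
by move=> redR a b ab0; apply: redR; rewrite mulrA -(mulrA b) ab0 mulr0 mul0r.
Qed.

(** Take a nonzero product x_g y_h with g h least, and g least among those.  In
    the coefficient of x y at g h, multiplied on the right by x_g, only
    x_g y_h x_g can survive: a term x_g' y_h' with g' < g vanishes by the choice
    of g, and if g < g' then h' < h, so that x_g y_h' = 0 by the choice of g h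
    and therefore y_h' x_g = 0.  Thus x_g y_h x_g = 0, and x_g y_h squares to
    zero. *)
Lemma reduced_Armendariz (d : Order.disp_t) (M : strictTotalMonoidType d)
    (R : pzRingType) (x y : monoid_ring R M) :
  (forall a : R, a * a = 0 -> a = 0) ->
  x * y = 0 -> forall g h, x@_g * y@_h = 0.
Proof.
move=> redR xy0.
pose s := [seq p <- [seq (g, h) | g <- msupp x, h <- msupp y]
          | x@_p.1 * y@_p.2 != 0].
have mem_s g h : ((g, h) \in s) = (x@_g * y@_h != 0).
  rewrite mem_filter /=; case: eqP => //= /eqP xy.
  apply/allpairsP; exists (g, h); split=> //=; rewrite -mcoeff_neq0.
    by apply: contraNneq xy => ->; rewrite mul0r.
  by apply: contraNneq xy => ->; rewrite mulr0.
have [s0 g h|sN0] := eqVneq s [::].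
  by apply/eqP; rewrite -[_ == 0]negbK -mem_s s0.
(* The lexicographic key encodes the choice of a least g h, then a least g. *)
pose key (p : M * M) : M *l M := ((p.1 * p.2)%g, p.1).
have [[g h] gh_s gh_min] := exists_seq_min key sN0.
have below g' h' : (key (g', h') < key (g, h))%O -> x@_g' * y@_h' = 0.
  move=> lt_gh; apply/eqP; rewrite -[_ == 0]negbK -mem_s.
  by apply: contraL lt_gh => /gh_min; rewrite -leNgt.
have nz : x@_g * y@_h != 0 by rewrite -mem_s.
have others g' h' : (g', h') != (g, h) ->
    (x@_g' * y@_h') *+ ((g' * h')%g == (g * h)%g) * x@_g = 0.
  case: (_ =P (g * h)%g) => [eq_gh|_]; last by rewrite mulr0n mul0r.
  rewrite mulr1n xpair_eqE; case: (ltgtP g' g) => [lt_g|lt_g|g'g /=] ne.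
  - rewrite below ?mul0r // /key /= ltEprodlexi /= eq_gh lexx /=.
    by rewrite lt_g.
  - have lt_h : (h' < h)%O.
      rewrite ltNge; apply/negP => le_h.
      have := lt_mulgr _ _ h lt_g; rewrite -eq_gh ltNge => /negP; apply.
      move: le_h; rewrite le_eqVlt => /predU1P[->//|/(lt_mulgl _ _ g')].
      exact: ltW.
    have xy' : x@_g * y@_h' = 0.
      apply: below; rewrite /key ltEprodlexi /=.
      by rewrite (ltW (lt_mulgl _ _ g lt_h)) leNgt (lt_mulgl _ _ g lt_h).
    by rewrite -mulrA (reduced_mul0C redR xy') mulr0.
  - rewrite g'g in eq_gh; case: (ltgtP h' h) ne => [lt_h|lt_h|] _ //.
      by have := lt_mulgl _ _ g lt_h; rewrite -eq_gh ltxx.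
    by have := lt_mulgl _ _ g lt_h; rewrite -eq_gh ltxx.
have /andP[xg yh] : (g \in msupp x) && (h \in msupp y).
  rewrite -!mcoeff_neq0; apply/andP; split; apply: contraNneq nz => ->.
    by rewrite mul0r.
  by rewrite mulr0.
have : (x * y)@_(g * h)%g * x@_g = 0 by rewrite xy0 mcoeff0 mul0r.
rewrite mcoeff_mul (bigD1_seq g) ?fset_uniq //= mulrDl.
rewrite [X in _ + X]mulr_suml [X in _ + X]big1 => [|g' ne]; last first.
  rewrite mulr_suml big1 // => h' _; apply: others.
  by rewrite xpair_eqE (negPf ne).
rewrite addr0 (bigD1_seq h) ?fset_uniq //= mulrDl.
rewrite [X in _ + X]mulr_suml [X in _ + X]big1 => [|h' ne]; last first.
  by apply: others; rewrite xpair_eqE (negPf ne) andbF.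
rewrite addr0 eqxx mulr1n => xyx.
have /redR xyE : x@_g * y@_h * (x@_g * y@_h) = 0 by rewrite mulrA xyx mul0r.
by rewrite xyE eqxx in nz.
Qed.

(** Multiplying by a constant acts on each coefficient, so the annihilator of W
    is e R[M], where e generates the annihilator in R of all coefficients of
    the elements of W. *)
Lemma Baer_monoid_ring (d : Order.disp_t) (M : strictTotalMonoidType d)
    (R : pzRingType) :
  (forall a : R, a * a = 0 -> a = 0) ->
  Baer R -> Baer (monoid_ring R M).
Proof.
move=> redR baerR W [w0 Ww0].
have [|e [ee annE]] := baerR (fun c => exists w g, W w /\ c = w@_g).
  by exists w0@_1%g, w0, 1%g.
exists (mr_term e (1%g : M)); split.
  by rewrite mr_termM ee mulg1.
move=> s; split=> [Ws0|[t ->] w Ww].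
  exists s; apply/malgP => k; rewrite mcoeff_constl.
  have [|t ->] := proj1 (annE s@_k); last by rewrite mulrA ee.
  by move=> _ [w [g [Ww ->]]]; apply: reduced_Armendariz => //; apply: Ws0.
rewrite mulrA [w * _](_ : _ = 0) ?mul0r //.
apply/malgP => k; rewrite mcoeff_constr mcoeff0.
by apply: (proj2 (annE e)); [exists e; rewrite ee | exists w, k].
Qed.

(** The idempotent f that generates the annihilator of the constants in W may
    have many coefficients, but f_1 suffices: it annihilates W because f does,
    and f s = s, for a constant s of the annihilator, reads f_1 s = s at the
    coefficient 1. *)
Lemma Baer_coefficient_ring (M : monoidType) (R : pzRingType) :
  Baer (monoid_ring R M) -> Baer R.
Proof.
move=> baerRM W [w0 Ww0].
pose const c : monoid_ring R M := mr_term c 1%g.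
have [|f [ff annf]] := baerRM (fun u => exists2 w, W w & u = const w).
  by exists (const w0), w0.
have We w : W w -> w * f@_1%g = 0.
  move=> Ww; have wf0 : const w * f = 0.
    by apply: (proj2 (annf f)); [exists f; rewrite ff | exists w].
  by rewrite -mcoeff_constl -/(const w) wf0 mcoeff0.
(* The left identity on the annihilator gives both the idempotence of f_1 and
   the inclusion of the annihilator in f_1 R. *)
have eid s : (forall w, W w -> w * s = 0) -> s = f@_1%g * s.
  move=> Ws0; have [|t st] := proj1 (annf (const s)).
    move=> _ [w Ww ->]; rewrite mr_termM Ws0 //; exact: monalgU0.
  have : const s = f * const s by rewrite st mulrA ff.
  by move/(congr1 (mcoeff 1%g)); rewrite mcoeff_constr mcoeffUU.
exists f@_1%g; split; first exact/esym/eid.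
move=> s; split=> [/eid ->|[t ->] w Ww]; first by exists s.
by rewrite mulrA We // mul0r.
Qed.

Theorem theorem2p19 (d : Order.disp_t) (M : strictTotalMonoidType d)
    (hM : exists g h : M, g <> h)
    (R : pzRingType) (hR : central_Armendariz M R) :
  Baer R <-> Baer (monoid_ring R M).
Proof.
split=> [baerR|]; last exact: Baer_coefficient_ring.
have [k k1] : exists k : M, k != 1%g.
  have [g [h gh]] := hM; have [g1|] := eqVneq g 1%g; last by exists g.
  by exists h; apply/eqP => h1; apply: gh; rewrite g1 h1.
apply: Baer_monoid_ring => //; apply: abelian_Baer_reduced => //.
exact: central_Armendariz_idem_central k1 hR.
Qed.
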